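(* Let $\nu_1,\nu_2\ge 0$ and let $\mathcal{L}_n^{(\nu_1,\nu_2)}$ ($n\ge1$) be the Stancu type operators including generalized Brenke polynomials associated with $A_1,A_2,h$ as in the context. Let $0<\alpha\le1$, $M>0$, and let $f:[0,\infty)\to\mathbb{R}$ satisfy $$|f(t_1)-f(t_2)|\le M|t_1-t_2|^\alpha\qquad\text{for all } t_1,t_2\in[0,\infty).$$ Then for every $n\ge1$ and $x\ge0$, $$\left|\mathcal{L}_n^{(\nu_1,\nu_2)}(f;x)-f(x)\right|\le M\,\delta_n^{\alpha}(x),$$ where $\delta_n(x):=\sqrt{\mathcal{L}_n^{(\nu_1,\nu_2)}\left((s-x)^2;x\right)}$.
   Context: Setting. Let $R>1$. Let $A_1,A_2:\mathbb{R}\to(0,\infty)$ and $h$ be functions, analytic on $\{t:|t|<R\}$ with (real) power series expansions convergent for $|t|<R$: $A_1(t)=\sum_{k\ge0}a_{1,k}t^k$ with $a_{1,0}\neq0$; $A_2(t)=\sum_{k\ge0}a_{2,k}t^k$ with $a_{2,k}\ne0$ for all $k$; $h(t)=\sum_{k\ge1}h_kt^k$ with $h_1\neq0$. The generalized Brenke polynomials $\pi_k$ ($k\ge 0$) are the polynomials with $$A_1(h(t))\,A_2(xh(t))=\sum_{k=0}^\infty \pi_k(x)t^k ,$$ where the series converges and the identity holds for real $t$ with $|t|<R$ and every $x\in[0,\infty)$. It is assumed that $h'(1)=1$ and $\pi_k(x)\ge0$ for all $k\ge0$ and $x\in[0,\infty)$. Operators. For $\nu_1,\nu_2\ge0$,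 $n\ge1$, $x\in[0,\infty)$ and $f:[0,\infty)\to\mathbb{R}$ (for which the series converges), $$\mathcal{L}_n^{(\nu_1,\nu_2)}(f;x)=\frac{1}{A_1(h(1))A_2(nxh(1))}\sum_{k=0}^\infty\pi_k(nx)\,f\!\left(\frac{k+\nu_1}{n+\nu_2}\right).$$ In $\mathcal{L}_n^{(\nu_1,\nu_2)}((s-x)^2;x)$ the operator acts on the function $s\mapsto(s-x)^2$, with $x$ fixed. *)

(* Defs.v *)
From HB Require Import structures.
From mathcomp Require Import all_boot all_order all_algebra.
From mathcomp Require Import all_classical all_reals all_analysis.

Set Implicit Arguments.
Unset Strict Implicit.
Unset Printing Implicit Defensive.

Import Order.TTheory GRing.Theory Num.Theory.
Import numFieldNormedType.Exports.

Local Open Scope classical_set_scope.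
Local Open Scope ring_scope.

Definition has_power_series (R : realType) (rho : R) (F : R -> R)
    (c : nat -> R) : Prop :=
  forall t : R, `|t| < rho -> pseries c t @ \oo --> F t.

(* [A2] is a function on the whole line, so that [A2 (x * h t)] makes sense even
   when [x * h t] lies outside the disc of convergence of its power series. *)
Definition generalized_brenke (R : realType) (rho : R) (A1 A2 h : R -> R)
    (p : nat -> {poly R}) : Prop :=
  forall t x : R, `|t| < rho -> 0 <= x ->
    pseries (fun k => (p k).[x]) t @ \oo --> A1 (h t) * A2 (x * h t).

(* [f] is only evaluated at nonnegative points when [nu1], [nu2] are
   nonnegative, so a total [f : R -> R] stands for a function on [0, +oo[. *)
Definition stancu_brenke (R : realType) (A1 A2 h : R -> R) (p : nat -> {poly R})
    (nu1 nu2 : R) (n : nat) (f : R -> R) (x : R) : R :=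
  (A1 (h 1) * A2 (n%:R * x * h 1))^-1 *
  limn (series (fun k : nat =>
    (p k).[n%:R * x] * f ((k%:R + nu1) / (n%:R + nu2)))).

Definition stancu_brenke_delta (R : realType) (A1 A2 h : R -> R)
    (p : nat -> {poly R}) (nu1 nu2 : R) (n : nat) (x : R) : R :=
  Num.sqrt (stancu_brenke A1 A2 h p nu1 nu2 n (fun s => (s - x) ^+ 2) x).

(* Main.v *)
(** The weights [(p k).[n x]], divided by their sum [A1 (h 1) * A2 (n x h 1)],
    form a probability distribution on the nodes [s_k = (k + nu1) / (n + nu2)],
    and they have a finite second moment because the generating series converges
    at some [t > 1]. The Hölder condition bounds [|f s_k - f x|] by
    [M |s_k - x|^alpha], and Jensen's inequality for the concave function
    [v |-> v^(alpha/2)] concludes. Jensen is used through the tangent at the mean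
    [delta^2], which is a pointwise bound that can be summed termwise. *)
Require Import Defs.
From HB Require Import structures.
From mathcomp Require Import all_boot all_order all_algebra.
From mathcomp Require Import all_classical all_reals all_analysis.
From mathcomp Require Import ring lra.
Import Order.TTheory GRing.Theory Num.Theory.
Import numFieldNormedType.Exports.
Local Open Scope classical_set_scope.
Local Open Scope ring_scope.

(** Young's inequality for the product of [(u / d)]^ alpha[and 1, with conjugate exponents]2 /
    alpha[and]2 / (2 - alpha)[. As a function of]v = u ^+
    2[, the right-hand side is the tangent to]v [^ (alpha / 2)] at [v = d ^+ 2]. *)
Lemma powR_le_sqr_tangent (R : realType) (alpha d u : R) :
  0 < alpha -> alpha < 2 -> 0 < d -> 0 <= u ->
  u `^ alpha <= d `^ alpha * (1 - alpha / 2 + alpha / 2 * (u / d) ^+ 2).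
Proof.
move=> a_gt0 a_lt2 d_gt0 u_ge0.
have ud_ge0 : 0 <= u / d by rewrite divr_ge0// ltW.
have -> : u `^ alpha = d `^ alpha * (u / d) `^ alpha.
  by rewrite -powRM// ?ltW// mulrC divfK ?gt_eqF.
rewrite ler_wpM2l ?powR_ge0//.
have a0 : alpha != 0 by lra.
have a2 : 2 - alpha != 0 by lra.
have := @conjugate_powR R ((u / d) `^ alpha) 1 (2 / alpha) (2 / (2 - alpha))
  (powR_ge0 _ _) ler01 _ _ _.
rewrite mulr1 powR1 -powRrM [alpha * _]mulrC divfK// powR_mulrn// !invf_div.
move=> /(_ _ _ _) young; apply: (le_trans (young _ _ _)).
- by rewrite divr_gt0.
- by rewrite divr_gt0// subr_gt0.
- by field.
- by rewrite le_eqVlt; apply/orP; left; apply/eqP; field; lra.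
Qed.

Lemma term_le_lim_series (R : realType) (v : nat -> R) (k : nat) :
  (forall i, 0 <= v i) -> cvgn (series v) -> v k <= limn (series v).
Proof.
move=> v_ge0 cv; apply: le_trans (nondecreasing_cvgn_le _ cv k.+1).
  by rewrite /series/= big_nat_recr//= lerDr sumr_ge0.
by apply/nondecreasing_seqP => i; rewrite /series/= big_nat_recr//= lerDl.
Qed.

(** The estimate for abstract weights: [u k] stands for the distance from the node [s_k] to [x],
    [g k] for [f s_k] and [c] for [f x]. Convergence of the series with [g] is derived by domination
    rather than assumed. *)
Lemma holder_weighted_mean_le (R : realType) (w u g : nat -> R)
    (W c alpha M : R) :
  (forall k, 0 <= w k) -> (forall k, 0 <= u k) -> 0 < W ->
  series w @ \oo --> W -> cvgn (series (fun k => w k * u k ^+ 2)) ->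
  0 < alpha -> alpha < 2 -> 0 <= M ->
  (forall k, `|g k - c| <= M * u k `^ alpha) ->
  `|W^-1 * limn (series (fun k => w k * g k)) - c| <=
    M * Num.sqrt (W^-1 * limn (series (fun k => w k * u k ^+ 2))) `^ alpha.
Proof.
move=> w_ge0 u_ge0 W_gt0 wW cvS a_gt0 a_lt2 M_ge0 gc.
set S := limn (series (fun k => w k * u k ^+ 2)).
set d := Num.sqrt _.
have wu_ge0 k : 0 <= w k * u k ^+ 2 by rewrite mulr_ge0// sqr_ge0.
have S_ge0 : 0 <= S by apply: le_trans (term_le_lim_series _ _ 0%N wu_ge0 cvS).
have dd : d ^+ 2 = W^-1 * S by rewrite sqr_sqrtr// mulr_ge0// invr_ge0 ltW.
(* The line [a + b * v] touches [v]^ (alpha / 2)[at the weighted mean]d ^+ 2[of the]u k ^+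
   2[, so the summed bound equals]W * d [^ alpha] with no loss. *)
have [a [b [abE wuab]]] : exists a b, a * W + b * S = W * d `^ alpha /\
    forall k, w k * u k `^ alpha <= w k * (a + b * u k ^+ 2).
  (* At [d = 0] there is no tangent. But then the nonnegative terms [w k * u k ^+ 2] sum to 0, so
     [w k] or [u k] vanishes for each [k], and the zero line suffices. *)
  have [d0|d_neq0] := eqVneq d 0.
    exists 0, 0; split => [|k]; first by rewrite d0 powR0 ?gt_eqF//; ring.
    have S0 : S = 0.
      by move: dd; rewrite d0 expr0n => /esym/eqP;
         rewrite mulf_eq0 invr_eq0 gt_eqF//= => /eqP.
    have : w k * u k ^+ 2 == 0.
      by rewrite eq_le wu_ge0 -S0 term_le_lim_series.
    rewrite mulf_eq0 sqrf_eq0 => /orP[/eqP->|/eqP->]; first by rewrite !mul0r.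
    by rewrite powR0 ?gt_eqF// mul0r addr0.
  have d_gt0 : 0 < d by rewrite lt_def d_neq0 sqrtr_ge0.
  exists (d `^ alpha * (1 - alpha / 2)), (d `^ alpha * (alpha / 2 / d ^+ 2)).
  have SE : S = W * d ^+ 2 by rewrite dd mulVKf ?gt_eqF.
  split => [|k].
  - by rewrite SE; field.
  - rewrite ler_wpM2l//; apply: le_trans (powR_le_sqr_tangent _ _ d _ _ _ _ _) _ => //.
    by rewrite le_eqVlt; apply/orP; left; apply/eqP; field.
pose T k := M * (a * w k + b * (w k * u k ^+ 2)).
have TT : series T @ \oo --> M * (a * W + b * S).
  have -> : series T = fun n => M * (a * series w n
      + b * series (fun k => w k * u k ^+ 2) n).
    apply/funext => n; rewrite /series/= [in RHS]mulr_sumr [X in _ + X]mulr_sumr.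
    by rewrite -big_split/= mulr_sumr.
  by apply: cvgMl_tmp; apply: cvgD; apply: cvgMl_tmp.
have dT k : `|w k * (g k - c)| <= T k.
  rewrite normrM ger0_norm// /T.
  apply: (@le_trans _ _ (M * (w k * u k `^ alpha))).
    by rewrite mulrCA ler_wpM2l.
  by rewrite ler_wpM2l//; apply: le_trans (wuab k) _; rewrite mulrDr mulrC mulrCA.
have cvT : cvgn (series T) by apply/cvg_ex; eexists; exact: TT.
(* Absolute convergence makes the [limn] of this series a true sum; adding back [c * W] then gives
   the sum with [g]. *)
have cvnorm : cvgn [normed series (fun k => w k * (g k - c))].
  by apply: (@series_le_cvg _ _ T) => // k; rewrite /= ?(le_trans _ (dT k)).
have cvd := normed_cvg cvnorm.
have wgW : series (fun k => w k * g k) @ \oo -->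
    limn (series (fun k => w k * (g k - c))) + c * W.
  have -> : series (fun k => w k * g k) =
      fun n => series (fun k => w k * (g k - c)) n + c * series w n.
    apply/funext => n; rewrite /series/= mulr_sumr -big_split/=.
    by apply: eq_bigr => k _; ring.
  by apply: cvgD => //; apply: cvgMl_tmp.
rewrite (cvg_lim _ wgW)// mulrDr mulrCA mulVf ?gt_eqF// mulr1 addrK.
rewrite normrM gtr0_norm ?invr_gt0// ler_pdivrMl// mulrCA -abE -(cvg_lim _ TT)//.
by apply: le_trans (lim_series_norm cvnorm) _; exact: lim_series_le.
Qed.

Lemma bernoulli_le_exprn (R : realDomainType) (e : R) (k : nat) :
  0 <= e -> 1 + k%:R * e <= (1 + e) ^+ k.
Proof.
move=> e_ge0; elim: k => [|k IHk]; first by rewrite mul0r addr0 expr0.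
rewrite exprS; apply: (@le_trans _ _ ((1 + e) * (1 + k%:R * e))).
  have : 0 <= k%:R * e ^+ 2 by rewrite mulr_ge0// sqr_ge0.
  by rewrite -natr1; lra.
by rewrite ler_wpM2l// addr_ge0.
Qed.

Lemma cvg_series_affine_sqr (R : realType) (w : nat -> R) (t c : R) :
  (forall k, 0 <= w k) -> 1 < t -> cvgn (pseries w t) -> 0 <= c ->
  cvgn (series (fun k => w k * (k%:R + c) ^+ 2)).
Proof.
move=> w_ge0 t_gt1 cvt c_ge0.
(* With [sqrt t = 1 + e], [k + c <= D (1 + k e) <= D (sqrt t)^k], so that
   [(k + c)^2 <= D^2 t^k]. *)
pose e := Num.sqrt t - 1.
have e_gt0 : 0 < e by rewrite subr_gt0 -[ltLHS]sqrtr1 ltr_sqrt//; lra.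
(* In [D * (1 + k%:R * e)], the product of [e^-1] with [k%:R * e] yields [k], and that of [c] with 1
   yields [c]; the remaining terms are nonnegative. *)
pose D := e^-1 + c.
have D_ge0 : 0 <= D by rewrite addr_ge0// invr_ge0 ltW.
apply: (@series_le_cvg _ _ (fun k => D ^+ 2 * (w k * t ^+ k))) => [k|k|k|].
- by rewrite mulr_ge0// sqr_ge0.
- by rewrite !mulr_ge0// exprn_ge0//; lra.
- rewrite [leRHS]mulrCA ler_wpM2l//.
  have <- : (Num.sqrt t) ^+ 2 = t by rewrite sqr_sqrtr//; lra.
  rewrite exprAC -exprMn ler_pXn2r// ?nnegrE ?addr_ge0// ?mulr_ge0 ?exprn_ge0 ?sqrtr_ge0//.
  apply: (@le_trans _ _ (D * (1 + k%:R * e))); last first.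
    rewrite ler_wpM2l//; have -> : Num.sqrt t = 1 + e by rewrite /e; ring.
    by apply: bernoulli_le_exprn; exact: ltW.
  have -> : D * (1 + k%:R * e) = k%:R + c + (e^-1 + c * k%:R * e).
    by rewrite /D; field; rewrite gt_eqF.
  by rewrite lerDl addr_ge0// ?invr_ge0 ?mulr_ge0// ltW.
- exact: (@is_cvg_seriesZ _ _ (D ^+ 2) cvt).
Qed.

Theorem theorem2p3 (R : realType) (rho : R) (rho_gt1 : 1 < rho)
    (A1 A2 h : R -> R) (a1 a2 hc : nat -> R)
    (A1_gt0 : forall t : R, 0 < A1 t)
    (A2_gt0 : forall t : R, 0 < A2 t)
    (A1_ps : has_power_series rho A1 a1)
    (a1_0 : a1 0%N != 0)
    (A2_ps : has_power_series rho A2 a2)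
    (a2_neq0 : forall k : nat, a2 k != 0)
    (h_ps : has_power_series rho h hc)
    (hc_0 : hc 0%N = 0)
    (hc_1 : hc 1%N != 0)
    (p : nat -> {poly R})
    (p_brenke : generalized_brenke rho A1 A2 h p)
    (dh1 : h^`()%classic 1 = 1)
    (p_ge0 : forall (k : nat) (x : R), 0 <= x -> 0 <= (p k).[x])
    (nu1 nu2 : R) (nu1_ge0 : 0 <= nu1) (nu2_ge0 : 0 <= nu2)
    (alpha M : R) (alpha_gt0 : 0 < alpha) (alpha_le1 : alpha <= 1)
    (M_gt0 : 0 < M)
    (f : R -> R)
    (f_holder : forall t1 t2 : R, 0 <= t1 -> 0 <= t2 ->
       `|f t1 - f t2| <= M * (`|t1 - t2| `^ alpha))
    (n : nat) (n_gt0 : (0 < n)%N) (x : R) (x_ge0 : 0 <= x) :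
  `|stancu_brenke A1 A2 h p nu1 nu2 n f x - f x|
    <= M * (stancu_brenke_delta A1 A2 h p nu1 nu2 n x) `^ alpha.
Proof.
have w_ge0 k : 0 <= (p k).[n%:R * x] by rewrite p_ge0// mulr_ge0.
have n_ge1 : 1 <= n%:R :> R by rewrite ler1n.
have nx_ge0 : 0 <= n%:R * x by rewrite mulr_ge0.
have nnu_ge1 : 1 <= n%:R + nu2 by lra.
have s_ge0 k : 0 <= (k%:R + nu1) / (n%:R + nu2).
  by rewrite divr_ge0 ?addr_ge0.
have wW : series (fun k => (p k).[n%:R * x]) @ \oo -->
    A1 (h 1) * A2 (n%:R * x * h 1).
  have -> : series (fun k => (p k).[n%:R * x]) =
      pseries (fun k => (p k).[n%:R * x]) 1.
    by apply/funext => m; apply: eq_bigr => k _; rewrite /= expr1n mulr1.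
  by apply: p_brenke; rewrite ?normr1.
(* Any point strictly between 1 and [rho] would do. *)
pose t := (1 + rho) / 2.
have cvt : cvgn (pseries (fun k => (p k).[n%:R * x]) t).
  apply/cvg_ex; eexists; apply: p_brenke => //.
  by rewrite ger0_norm /t; lra.
have cv2 : cvgn (series (fun k =>
    (p k).[n%:R * x] * `|(k%:R + nu1) / (n%:R + nu2) - x| ^+ 2)).
  have t_gt1 : 1 < t by rewrite /t; lra.
  (* Since [n + nu2] is at least 1, the distance from the node to [x] is at most [k + nu1 + x]. *)
  apply: series_le_cvg (cvg_series_affine_sqr _ _ _ (nu1 + x) w_ge0 t_gt1 cvt _)
    => [k|k|k|]; rewrite ?mulr_ge0 ?sqr_ge0 ?addr_ge0//.
  rewrite ler_wpM2l// ler_pXn2r ?nnegrE ?addr_ge0//.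
  apply: (le_trans (ler_normB _ _)); rewrite !ger0_norm// addrA lerD2r.
  by rewrite ler_pdivrMr ?ler_peMr ?addr_ge0//; lra.
rewrite /stancu_brenke_delta /stancu_brenke.
have -> : (fun k => (p k).[n%:R * x] *
      ((k%:R + nu1) / (n%:R + nu2) - x) ^+ 2) =
    (fun k => (p k).[n%:R * x] *
      `|(k%:R + nu1) / (n%:R + nu2) - x| ^+ 2).
  by apply/funext => k; rewrite real_normK ?num_real.
apply: holder_weighted_mean_le => //; [by rewrite mulr_gt0|lra|exact: ltW|].
by move=> k; exact: f_holder.
Qed.
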